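(* Let $\Omega$ be a countably infinite set and let $Q\in[0,1]^{\Omega\times\Omega}$ be the column-stochastic transition matrix of an irreducible, positive recurrent discrete-time Markov chain on $\Omega$. Then the whole space $\ell^1(\Omega)$ is mean ergodic with respect to $Q$, i.e. $\ell^1_{\mathrm{m.e.}}(\Omega,Q)=\ell^1(\Omega)$: for every $X\in\ell^1(\Omega)$ the limit $\lim_{M\to\infty}\frac1M\sum_{i=0}^{M-1}Q^iX$ exists with respect to $\|\cdot\|_1$.
   Context: $\ell^1(\Omega)$ is the space of real absolutely summable families with norm $\|X\|_1=\sum_{\omega\in\Omega}|X^{(\omega)}|$. The entry $Q^{(i,j)}=\mathbb P(X_{n+1}=i\mid X_n=j)$ is the probability of a transition from $j$ to $i$; column-stochastic means $\sum_{i\in\Omega}Q^{(i,j)}=1$ for all $j$. $Q$ acts by $(QX)^{(i)}=\sum_jQ^{(i,j)}X^{(j)}$. The mean ergodic subspace is $$\ell^1_{\mathrm{m.e.}}(\Omega,Q)=\Bigl\{X\in\ell^1(\Omega):\lim_{M\to\infty}\tfrac1M\sum_{i=0}^{M-1}Q^iX\text{ exists with respect to }\|\cdot\|_1\Bigr\}.$$ The chain is irreducible if for all $i,j\in\Omega$ there is $m\in\mathbb N$ with $(Q^m)^{(i,j)}>0$. It is positive recurrent if for every initial state $X_0=\omega_0$ the return time $T_R=\inf\{k\ge1:X_k=\omega_0\}$ is almost surely finite and has finite expectation. *)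

(* Defs.v *)
From mathcomp Require Import all_boot all_order all_algebra.
From mathcomp Require Import all_classical all_reals all_analysis.
Set Implicit Arguments.
Unset Strict Implicit.
Unset Printing Implicit Defensive.
Import Order.TTheory GRing.Theory Num.Theory numFieldNormedType.Exports.
Local Open Scope classical_set_scope.
Local Open Scope ring_scope.

Definition countably_infinite (Omega : choiceType) : Prop :=
  countable [set: Omega] /\ infinite_set [set: Omega].

Section ell1.
Context {R : realType} {Omega : choiceType}.
Implicit Types X Y : Omega -> R.

Definition norm1 X : \bar R := (\esum_(w in [set: Omega]) `|X w|%:E)%E.

Definition ell1 : set (Omega -> R) := [set X | (norm1 X < +oo)%E].

(* [\esum] is a supremum over finite subsums, hence is only meaningful for
   nonnegative families: an absolutely summable real family is summed through
   its positive and negative parts. *)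
Definition rsum X : R :=
  fine (\esum_(w in [set: Omega]) (Num.max (X w) 0)%:E)%E
  - fine (\esum_(w in [set: Omega]) (Num.max (- X w) 0)%:E)%E.

Definition cvg1 (u : nat -> Omega -> R) Y : Prop :=
  norm1 (u M \- Y) @[M --> \oo] --> (0 : \bar R)%E.

End ell1.

Section transition_matrix.
Context {R : realType} {Omega : choiceType}.
(* [Q i j] is the probability of a transition from [j] to [i]. *)
Implicit Types (Q : Omega -> Omega -> R) (X : Omega -> R).

Definition column_stochastic Q : Prop :=
  (forall i j, 0 <= Q i j <= 1) /\
  (forall j, \esum_(i in [set: Omega]) (Q i j)%:E = 1)%E.

Definition act Q X : Omega -> R := fun i => rsum (fun j => Q i j * X j).

Fixpoint mpow Q (m : nat) (i j : Omega) : R :=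
  if m is m'.+1 then rsum (fun k => Q i k * mpow Q m' k j) else (i == j)%:R.

Definition irreducible Q : Prop := forall i j, exists m, 0 < mpow Q m i j.

(* At [M = 0] this is the zero family, which is irrelevant for the limit. *)
Definition cesaro Q X (M : nat) : Omega -> R :=
  fun w => M%:R^-1 * \sum_(i < M) iter i (act Q) X w.

Definition ell1_me Q : set (Omega -> R) :=
  [set X | ell1 X /\ exists2 Y, ell1 Y & cvg1 (cesaro Q X) Y].

End transition_matrix.

Section markov_chain.
Context {R : realType} {Omega : choiceType}.
Implicit Types (Q : Omega -> Omega -> R).

Definition cond_prob d (T : measurableType d) (P : probability T R)
  (A B : set T) : R := fine (P (A `&` B)) / fine (P B).

Definition history (T : Type) (X : nat -> T -> Omega) (s : nat -> Omega)
  (n : nat) : set T := [set t | forall k, (k <= n)%N -> X k t = s k].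

(* Time-homogeneous chain with one-step transition probabilities [Q]: given any
   history of positive probability, the next state is drawn from the column of
   [Q] indexed by the current state.  [Omega] carries the discrete
   sigma-algebra. *)
Definition markov_chain Q d (T : measurableType d) (P : probability T R)
  (X : nat -> T -> Omega) : Prop :=
  (forall n (A : set Omega), measurable (X n @^-1` A)) /\
  (forall n (s : nat -> Omega), P (history X s n) != 0%E ->
     cond_prob P (X n.+1 @^-1` [set s n.+1]) (history X s n) =
     Q (s n.+1) (s n)).

(* The infimum of the empty set is [+oo]. *)
Definition return_time (T : Type) (X : nat -> T -> Omega) (w0 : Omega)
  (t : T) : \bar R :=
  ereal_inf [set k%:R%:E | k in [set k : nat | (1 <= k)%N /\ X k t = w0]].

(* The law of a chain is determined by [Q] and its initial state, so the
   choice of the realization of the chain started at [w0] is immaterial. *)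
Definition positive_recurrent Q : Prop :=
  forall w0 : Omega, exists d (T : measurableType d) (P : probability T R)
    (X : nat -> T -> Omega),
  [/\ markov_chain Q P X,
      {ae P, forall t, X 0%N t = w0},
      {ae P, forall t, (return_time X w0 t < +oo)%E} &
      (\int[P]_t return_time X w0 t < +oo)%E].

End markov_chain.

(* Main.v *)
Require Import Defs.
From mathcomp Require Import all_boot all_order all_algebra.
From mathcomp Require Import all_classical all_reals all_analysis.
From mathcomp Require Import measurable_realfun ring zify.

Set Implicit Arguments.
Unset Strict Implicit.
Unset Printing Implicit Defensive.
Import Order.TTheory GRing.Theory Num.Theory numFieldNormedType.Exports.
Local Open Scope classical_set_scope.
Local Open Scope ring_scope.

(** Fix a state [w0] and let [A] be [Q] followed by erasing the entry at [w0].
    Then [Y - Q Y = c Y - c (A Y)] with [c Y = Y - (sum Y) delta_w0], and the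
    Cesaro means of a coboundary [Y - Q Y] tend to 0.  The norm of [A^N X] is at
    most [sum_j P_j(no visit to w0 during 1..N) |X_j|], which tends to 0: the
    probabilities at [j = w0] are summable by positive recurrence, and their
    decay spreads along transitions by irreducibility.  Hence the Cesaro means of
    every [X] with [sum X = 0] tend to 0.  Finally [mu = sum_m A^m delta_w0] has
    finite norm, at most the expected return time, and is [Q]-invariant, so the
    means of an arbitrary [X] converge to [(sum X / sum mu) mu]. *)

(** * Sums of nonnegative families *)

Section esum_complements.
Context {R : realType}.

Lemma esumZl (T : choiceType) (c : R) (a : T -> \bar R) : 0 <= c ->
  (forall i, 0 <= a i)%E ->
  (\esum_(i in [set: T]) (c%:E * a i) = c%:E * \esum_(i in [set: T]) a i)%E.
Proof.
move=> c0 a0; rewrite /esum -ereal_supZl//; last first.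
  by apply/set0P; exists (\sum_(x \in set0) a x)%E; exists set0 => //; exact: fsets_set0.
congr ereal_sup; apply/seteqP; split => [_ [A [fA AT] <-]|_ [_ [A [fA AT] <-] <-]].
  exists (\sum_(x \in A) a x)%E; first by exists A.
  by rewrite ge0_mule_fsumr.
by exists A => //; rewrite ge0_mule_fsumr.
Qed.

(** Tonelli for unordered sums: both sides are sums over the product, matched by swapping
    coordinates. *)
Lemma esum_interchange (T1 T2 : choiceType) (a : T1 -> T2 -> \bar R) :
  (forall i j, 0 <= a i j)%E ->
  (\esum_(i in [set: T1]) \esum_(j in [set: T2]) a i j =
   \esum_(j in [set: T2]) \esum_(i in [set: T1]) a i j)%E.
Proof.
move=> a0; rewrite !esum_esum//.
rewrite (reindex_esum ([set: T2] `*`` fun=> [set: T1]) _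
  (fun x => (x.2, x.1)))//; split => //=.
  by move=> [i1 i2] [j1 j2] /= _ _ [-> ->].
by move=> [i1 i2] _ /=; exists (i2, i1).
Qed.

Lemma esum_support1 (T : choiceType) (x : T) (a : T -> \bar R) : (0 <= a x)%E ->
  (forall i, i != x -> a i = 0)%E -> (\esum_(i in [set: T]) a i = a x)%E.
Proof.
move=> ax aN0; rewrite -(@esum_set1 _ _ x a)// [RHS]esum_mkcond.
apply: eq_esum => i _; case: ifPn => //; rewrite notin_setE/= => /eqP/aN0; exact.
Qed.

Lemma esum_ge1 (T : choiceType) (x : T) (a : T -> \bar R) :
  (forall i, 0 <= a i)%E -> (a x <= \esum_(i in [set: T]) a i)%E.
Proof.
move=> a0; apply: esum_ge; exists [set x]; last by rewrite fsbig_set1.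
by split => //; exact: finite_set1.
Qed.

Lemma esum_nat_recl (a : nat -> \bar R) : (forall m, 0 <= a m)%E ->
  (\esum_(m in [set: nat]) a m = a 0%N + \esum_(m in [set: nat]) a m.+1)%E.
Proof.
move=> a0; rewrite -!nneseries_esumT// nneseries_recl//; congr (_ + _)%E.
by rewrite -nneseries_addn//; under eq_eseriesr do rewrite addn1.
Qed.

Lemma esum_max0 (T : choiceType) (X : T -> R) : (forall i, 0 <= X i) ->
  (\esum_(i in [set: T]) (Num.max (X i) 0)%:E = \esum_(i in [set: T]) (X i)%:E)%E.
Proof. by move=> X0; apply: eq_esum => i _; rewrite max_l. Qed.

End esum_complements.

(** * The norm of [ell1] and signed sums *)

Section ell1_theory.
Context {R : realType} {Omega : choiceType}.
Implicit Types X Y : Omega -> R.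

Lemma norm1_ge0 X : (0 <= norm1 X)%E.
Proof. exact: esum_ge0. Qed.

Lemma ge0_norm1 X : (forall w, 0 <= X w) ->
  norm1 X = (\esum_(w in [set: Omega]) (X w)%:E)%E.
Proof. by move=> X0; apply: eq_esum => w _; rewrite ger0_norm. Qed.

Lemma le_norm1 X Y : (forall w, `|X w| <= `|Y w|) -> (norm1 X <= norm1 Y)%E.
Proof. by move=> XY; apply: le_esum => w _; rewrite lee_fin. Qed.

Lemma norm1_normr X : norm1 (fun w => `|X w|) = norm1 X.
Proof. by apply: eq_esum => w _; rewrite normr_id. Qed.

Lemma norm1_ge1 X w : (`|X w|%:E <= norm1 X)%E.
Proof. by apply: (@esum_ge1 _ _ w (fun w => `|X w|%:E)) => i; rewrite lee_fin. Qed.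

Lemma norm1D X Y : (norm1 (X \+ Y)%R <= norm1 X + norm1 Y)%E.
Proof.
rewrite -esumD//; apply: le_esum => w _.
by rewrite -EFinD lee_fin ler_normD.
Qed.

Lemma norm1Z a X : norm1 (fun w => a * X w) = (`|a|%:E * norm1 X)%E.
Proof. by rewrite -esumZl//; apply: eq_esum => w _; rewrite normrM EFinM. Qed.

Lemma norm1N X : norm1 (\- X) = norm1 X.
Proof. by apply: eq_esum => w _; rewrite normrN. Qed.

Lemma norm1_0 : norm1 (fun _ : Omega => 0 : R) = 0%E.
Proof. by apply: esum1 => w _; rewrite normr0. Qed.

Lemma le_ell1 X Y : (forall w, `|X w| <= `|Y w|) -> ell1 Y -> ell1 X.
Proof. by move=> /le_norm1; exact: le_lt_trans. Qed.

Lemma ell1_fin_num X : ell1 X -> norm1 X \is a fin_num.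
Proof. by move=> eX; rewrite ge0_fin_numE ?norm1_ge0. Qed.

Lemma ell1D X Y : ell1 X -> ell1 Y -> ell1 (X \+ Y).
Proof. by move=> eX eY; apply: le_lt_trans (norm1D X Y) _; exact: lte_add_pinfty. Qed.

Lemma ell1Z a X : ell1 X -> ell1 (fun w => a * X w).
Proof. by move=> eX; rewrite /ell1/= norm1Z lte_mul_pinfty. Qed.

Lemma ell1N X : ell1 X -> ell1 (\- X).
Proof. by rewrite /ell1/= norm1N. Qed.

Lemma ell1B X Y : ell1 X -> ell1 Y -> ell1 (X \- Y).
Proof. by move=> eX /ell1N; exact: ell1D. Qed.

Lemma ell1_pos X : ell1 X -> ell1 (fun w => Num.max (X w) 0).
Proof.
apply: le_ell1 => w; rewrite ger0_norm ?le_max ?lexx ?orbT//.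
by rewrite ge_max ler_norm normr_ge0.
Qed.

Lemma ell1_neg X : ell1 X -> ell1 (fun w => Num.max (- X w) 0).
Proof. by move/ell1N/ell1_pos. Qed.

Lemma max_subr_max (x : R) : Num.max x 0 - Num.max (- x) 0 = x.
Proof.
have [x0|x0] := leP 0 x; last by rewrite max_l ?oppr_ge0 1?ltW// sub0r opprK.
by rewrite max_r ?subr0// oppr_le0.
Qed.

Lemma rsum_ge0E X : (forall w, 0 <= X w) -> ell1 X ->
  (rsum X)%:E = (\esum_(w in [set: Omega]) (X w)%:E)%E.
Proof.
move=> X0 eX; rewrite /rsum esum_max0// [X in _ - fine X]esum1; last first.
  by move=> w _; rewrite max_r// oppr_le0.
by rewrite subr0 fineK// -ge0_norm1// ell1_fin_num.
Qed.

Lemma rsum_norm1 X : (forall w, 0 <= X w) -> ell1 X -> (rsum X)%:E = norm1 X.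
Proof. by move=> X0 eX; rewrite rsum_ge0E// ge0_norm1. Qed.

Lemma rsum_posneg X : ell1 X ->
  rsum X = rsum (fun w => Num.max (X w) 0) - rsum (fun w => Num.max (- X w) 0).
Proof.
move=> eX; apply: EFin_inj.
have m0 (Y : Omega -> R) w : 0 <= Num.max (Y w) 0 by rewrite le_max lexx orbT.
rewrite [RHS]EFinB (rsum_ge0E (m0 X) (ell1_pos eX)).
rewrite (rsum_ge0E (m0 (\- X)) (ell1_neg eX)).
have h Y : ell1 Y -> (\esum_(w in [set: Omega]) (Num.max (Y w) 0)%:E)%E \is a fin_num.
  by move=> /ell1_pos /ell1_fin_num; rewrite ge0_norm1.
by rewrite /rsum EFinB !fineK//; [exact/h/ell1N|exact: h].
Qed.

Lemma rsum_support1 x X : (forall w, w != x -> X w = 0) -> rsum X = X x.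
Proof.
move=> X0; rewrite /rsum !(@esum_support1 _ _ x).
- by rewrite max_subr_max.
- by rewrite lee_fin le_max lexx orbT.
- by move=> w /X0 ->; rewrite oppr0 maxxx.
- by rewrite lee_fin le_max lexx orbT.
- by move=> w /X0 ->; rewrite maxxx.
Qed.

Lemma ge0_rsumD X Y : (forall w, 0 <= X w) -> (forall w, 0 <= Y w) ->
  ell1 X -> ell1 Y -> rsum (X \+ Y) = rsum X + rsum Y.
Proof.
move=> X0 Y0 eX eY; apply: EFin_inj; rewrite [RHS]EFinD.
rewrite !rsum_ge0E//; [|by move=> w; rewrite addr_ge0|exact: ell1D].
by rewrite -esumD// => w _; rewrite lee_fin.
Qed.

(* Independence of the decomposition into a difference of nonnegative families. *)
Lemma rsum_diff X P N : (forall w, 0 <= P w) -> (forall w, 0 <= N w) ->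
  ell1 P -> ell1 N -> (forall w, X w = P w - N w) -> rsum X = rsum P - rsum N.
Proof.
move=> P0 N0 eP eN XE.
have eX : ell1 X by rewrite (_ : X = P \- N); [exact: ell1B|apply/funext].
(* Clearing the subtractions leaves the sums of $P + X^-$ and $X^+ + N$, nonnegative families that
   agree pointwise. *)
rewrite rsum_posneg//; apply/eqP; rewrite subr_eq addrAC eq_sym subr_eq; apply/eqP.
rewrite -!ge0_rsumD//; try (by [exact: ell1_neg|exact: ell1_pos]);
  try (by move=> w; rewrite le_max lexx orbT).
congr rsum; apply/funext => w /=.
have h := max_subr_max (X w); rewrite {3}XE in h.
by rewrite -(subrK (Num.max (- X w) 0) (Num.max (X w) 0)) h addrAC subrK.
Qed.

(** $X^+ + Y^+$ and $X^- + Y^-$ need not be the positive and negative parts of $X + Y$, hence the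
    appeal to [rsum_diff]. *)
Lemma rsumD X Y : ell1 X -> ell1 Y -> rsum (X \+ Y) = rsum X + rsum Y.
Proof.
move=> eX eY; have pos0 Z : (forall w : Omega, 0 <= Num.max (Z w) 0 :> R).
  by move=> w; rewrite le_max lexx orbT.
have neg0 Z : (forall w : Omega, 0 <= Num.max (- Z w) 0 :> R).
  by move=> w; rewrite le_max lexx orbT.
have [eXp eXn] := (ell1_pos eX, ell1_neg eX).
have [eYp eYn] := (ell1_pos eY, ell1_neg eY).
rewrite [in RHS](rsum_posneg eX) [in RHS](rsum_posneg eY) addrACA -opprD.
rewrite -!ge0_rsumD//; apply: rsum_diff.
- by move=> w; rewrite addr_ge0.
- by move=> w; rewrite addr_ge0.
- exact: ell1D.
- exact: ell1D.
- by move=> w; rewrite /= opprD addrACA !max_subr_max.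
Qed.

Lemma rsumN X : ell1 X -> rsum (\- X) = - rsum X.
Proof.
move=> eX; rewrite (rsum_posneg eX) (rsum_posneg (ell1N eX)) [RHS]opprB.
by congr (_ - rsum _); apply/funext => w; rewrite opprK.
Qed.

Lemma rsumB X Y : ell1 X -> ell1 Y -> rsum (X \- Y) = rsum X - rsum Y.
Proof. by move=> eX eY; rewrite -rsumN// -rsumD//; exact: ell1N. Qed.

Lemma ge0_rsumZ a X : 0 <= a -> (forall w, 0 <= X w) -> ell1 X ->
  rsum (fun w => a * X w) = a * rsum X.
Proof.
move=> a0 X0 eX; apply: EFin_inj; rewrite [RHS]EFinM !rsum_ge0E//.
- by rewrite -esumZl// => w; rewrite lee_fin.
- by move=> w; rewrite mulr_ge0.
- exact: ell1Z.
Qed.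

Lemma rsumZ a X : ell1 X -> rsum (fun w => a * X w) = a * rsum X.
Proof.
have m0 (Y : Omega -> R) w : 0 <= Num.max (Y w) 0 by rewrite le_max lexx orbT.
have pos (c : R) Y : 0 <= c -> ell1 Y -> rsum (fun w => c * Y w) = c * rsum Y.
  move=> c0 eY; rewrite (rsum_posneg eY) mulrBr.
  have [eYp eYn] := (ell1_pos eY, ell1_neg eY).
  rewrite -(ge0_rsumZ c0 (m0 Y) eYp) -(ge0_rsumZ c0 (m0 (\- Y)) eYn).
  apply: rsum_diff; [| |exact: ell1Z|exact: ell1Z|].
  - by move=> w; rewrite mulr_ge0// m0.
  - by move=> w; rewrite mulr_ge0// (m0 (\- Y)).
  - by move=> w; rewrite -mulrBr max_subr_max.
have [a0|a0] := leP 0 a; first exact: pos.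
move=> eX; rewrite -[in RHS](opprK a) mulNr -pos ?oppr_ge0 1?ltW//.
rewrite -rsumN; last exact: ell1Z.
by congr rsum; apply/funext => w; rewrite /= mulNr opprK.
Qed.

Lemma normr_rsum X : ell1 X -> (`|rsum X|%:E <= norm1 X)%E.
Proof.
move=> eX; rewrite -norm1_normr -rsum_norm1//; last by rewrite /ell1/= norm1_normr.
have m0 (Y : Omega -> R) w : 0 <= Num.max (Y w) 0 by rewrite le_max lexx orbT.
have nr Y : (forall w : Omega, 0 <= Y w) -> ell1 Y -> `|rsum Y| = rsum Y.
  by move=> Y0 eY; apply: ger0_norm; rewrite -lee_fin rsum_norm1// norm1_ge0.
have [eXp eXn] := (ell1_pos eX, ell1_neg eX).
rewrite lee_fin (rsum_posneg eX); apply: le_trans (ler_normB _ _) _.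
rewrite (nr _ (m0 X) eXp) (nr _ (m0 (\- X)) eXn).
rewrite -(ge0_rsumD (m0 X) (m0 (\- X)) eXp eXn).
rewrite (_ : _ \+ _ = fun w => `|X w|)//; apply/funext => w /=.
have [x0|x0] := leP 0 (X w); first by rewrite max_r ?oppr_le0 ?addr0 ?ger0_norm.
by rewrite max_l ?oppr_ge0 1?ltW// add0r ltr0_norm.
Qed.

Lemma norm1_support1 x X : (forall w, w != x -> X w = 0) -> norm1 X = `|X x|%:E.
Proof.
move=> X0; apply: esum_support1; first by rewrite lee_fin.
by move=> w /X0 ->; rewrite normr0.
Qed.

Lemma norm1_sum M (F : nat -> Omega -> R) :
  (norm1 (fun w => \sum_(i < M) F i w)%R <= \sum_(i < M) norm1 (F i))%E.
Proof.
elim: M => [|M IH].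
  rewrite big_ord0 (_ : (fun _ => _) = fun=> 0) ?norm1_0//.
  by apply/funext => w; rewrite big_ord0.
rewrite big_ord_recr/= (_ : (fun _ => _) =
  (fun w => \sum_(i < M) F i w) \+ F M).
  by apply: le_trans (norm1D _ _) _; exact: leeD2r.
by apply/funext => w; rewrite big_ord_recr.
Qed.

End ell1_theory.

(** * Column-stochastic operators and their Cesaro means *)

Section stochastic_operator.
Context {R : realType} {Omega : choiceType} (Q : Omega -> Omega -> R).
Hypothesis Q_stochastic : column_stochastic Q.
Implicit Types X Y : Omega -> R.

Let Q_ge0 i j : 0 <= Q i j.
Proof. by have [/(_ i j)/andP[]] := Q_stochastic. Qed.

Let Q_le1 i j : Q i j <= 1.
Proof. by have [/(_ i j)/andP[]] := Q_stochastic. Qed.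

Let Q_sum1 j : (\esum_(i in [set: Omega]) (Q i j)%:E = 1)%E.
Proof. by have [_] := Q_stochastic. Qed.

Lemma ell1_row i X : ell1 X -> ell1 (fun j => Q i j * X j).
Proof. by apply: le_ell1 => j; rewrite normrM ler_piMl// ger0_norm. Qed.

Lemma ge0_actE X i : (forall j, 0 <= X j) -> ell1 X ->
  (act Q X i)%:E = (\esum_(j in [set: Omega]) (Q i j * X j)%:E)%E.
Proof.
move=> X0 eX; rewrite /act rsum_ge0E//; last exact: ell1_row.
by move=> j; rewrite mulr_ge0.
Qed.

Lemma act_ge0 X i : (forall j, 0 <= X j) -> ell1 X -> 0 <= act Q X i.
Proof.
move=> X0 eX; rewrite -lee_fin ge0_actE//.
by apply: esum_ge0 => j _; rewrite lee_fin mulr_ge0.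
Qed.

Lemma actD X Y : ell1 X -> ell1 Y -> act Q (X \+ Y) = act Q X \+ act Q Y.
Proof.
move=> eX eY; apply/funext => i; rewrite /act /=.
rewrite -(rsumD (ell1_row i eX) (ell1_row i eY)).
by congr rsum; apply/funext => j /=; rewrite mulrDr.
Qed.

Lemma actN X : ell1 X -> act Q (\- X) = \- act Q X.
Proof.
move=> eX; apply/funext => i; rewrite /act /= -(rsumN (ell1_row i eX)).
by congr rsum; apply/funext => j /=; rewrite mulrN.
Qed.

Lemma actB X Y : ell1 X -> ell1 Y -> act Q (X \- Y) = act Q X \- act Q Y.
Proof. by move=> eX eY; rewrite actD ?actN//; exact: ell1N. Qed.

Lemma act_normr X i : ell1 X -> `|act Q X i| <= act Q (fun j => `|X j|) i.
Proof.
move=> eX; have eaX : ell1 (fun j => `|X j|) by rewrite /ell1/= norm1_normr.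
rewrite -lee_fin ge0_actE//; apply: le_trans (normr_rsum (ell1_row i eX)) _.
by apply: le_esum => j _; rewrite normrM (ger0_norm (Q_ge0 _ _)).
Qed.

(** Tonelli moves [Q] from [X] to the weight [v]. The weight 1 gives conservation of mass; the
    weight [off (avoid m)] controls the iterates of [killed]. *)
Lemma act_duality (v : Omega -> R) X : (forall i, 0 <= v i) ->
  (forall j, 0 <= X j) -> ell1 X ->
  (\esum_(i in [set: Omega]) (v i * act Q X i)%:E =
   \esum_(j in [set: Omega])
     ((X j)%:E * \esum_(i in [set: Omega]) (v i * Q i j)%:E))%E.
Proof.
move=> v0 X0 eX.
transitivity (\esum_(i in [set: Omega]) \esum_(j in [set: Omega])
    (v i * (Q i j * X j))%:E)%E.
  apply: eq_esum => i _; rewrite EFinM ge0_actE// -esumZl//.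
  by move=> j; rewrite lee_fin mulr_ge0.
rewrite esum_interchange; last by move=> i j; rewrite lee_fin !mulr_ge0.
apply: eq_esum => j _; rewrite -esumZl//; last first.
  by move=> i; rewrite lee_fin mulr_ge0.
by apply: eq_esum => i _; rewrite -EFinM mulrA mulrC.
Qed.

Lemma ge0_norm1_act X : (forall j, 0 <= X j) -> ell1 X ->
  norm1 (act Q X) = norm1 X.
Proof.
move=> X0 eX; rewrite ge0_norm1; last by move=> i; exact: act_ge0.
have -> : (\esum_(i in [set: Omega]) (act Q X i)%:E =
    \esum_(i in [set: Omega]) (1 * act Q X i)%:E)%E.
  by apply: eq_esum => i _; rewrite mul1r.
rewrite (act_duality (v := fun=> 1))// ge0_norm1//.
apply: eq_esum => j _; rewrite [X in (_ * X)%E](_ : _ = 1%E) ?mule1//.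
by rewrite -(Q_sum1 j); apply: eq_esum => i _; rewrite mul1r.
Qed.

Lemma norm1_act X : ell1 X -> (norm1 (act Q X) <= norm1 X)%E.
Proof.
move=> eX; have eaX : ell1 (fun j => `|X j|) by rewrite /ell1/= norm1_normr.
rewrite -(norm1_normr X) -(ge0_norm1_act (X := fun j => `|X j|))//; apply: le_norm1 => i.
by rewrite [leRHS]ger0_norm ?act_normr// act_ge0.
Qed.

Lemma ell1_act X : ell1 X -> ell1 (act Q X).
Proof. by move=> eX; apply: le_lt_trans (norm1_act eX) eX. Qed.

Lemma rsum_act X : ell1 X -> rsum (act Q X) = rsum X.
Proof.
move=> eX; have [eXp eXn] := (ell1_pos eX, ell1_neg eX).
have m0 (Y : Omega -> R) w : 0 <= Num.max (Y w) 0 by rewrite le_max lexx orbT.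
have ge0 Y : (forall w, 0 <= Y w) -> ell1 Y -> rsum (act Q Y) = rsum Y.
  move=> Y0 eY; apply: EFin_inj; rewrite !rsum_norm1//.
  - exact: ge0_norm1_act.
  - by move=> i; exact: act_ge0.
  - exact: ell1_act.
rewrite (rsum_posneg eX) -(ge0 _ (m0 X) eXp) -(ge0 _ (m0 (\- X)) eXn).
rewrite -rsumB; [|exact: ell1_act|exact: ell1_act].
rewrite -actB//; congr rsum; congr act; apply/funext => w /=.
by rewrite max_subr_max.
Qed.

Lemma ell1_iter_act n X : ell1 X -> ell1 (iter n (act Q) X).
Proof. by move=> eX; elim: n => //= n; exact: ell1_act. Qed.

Lemma norm1_iter_act n X : ell1 X -> (norm1 (iter n (act Q) X) <= norm1 X)%E.
Proof.
move=> eX; elim: n => //= n; apply: le_trans.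
exact/norm1_act/ell1_iter_act.
Qed.

Lemma iter_actD n X Y : ell1 X -> ell1 Y ->
  iter n (act Q) (X \+ Y) = iter n (act Q) X \+ iter n (act Q) Y.
Proof.
by move=> eX eY; elim: n => //= n ->; rewrite actD//; exact: ell1_iter_act.
Qed.

Lemma iter_actN n X : ell1 X -> iter n (act Q) (\- X) = \- iter n (act Q) X.
Proof. by move=> eX; elim: n => //= n ->; rewrite actN//; exact: ell1_iter_act. Qed.

Lemma cesaroD X Y M : ell1 X -> ell1 Y ->
  Defs.cesaro Q (X \+ Y) M = Defs.cesaro Q X M \+ Defs.cesaro Q Y M.
Proof.
move=> eX eY; apply/funext => w; rewrite /Defs.cesaro /= -mulrDr -big_split.
by congr (_ * _); apply: eq_bigr => i _; rewrite iter_actD.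
Qed.

Lemma cesaroN X M : ell1 X -> Defs.cesaro Q (\- X) M = \- Defs.cesaro Q X M.
Proof.
move=> eX; apply/funext => w; rewrite /Defs.cesaro /= -mulrN -sumrN.
by congr (_ * _); apply: eq_bigr => i _; rewrite iter_actN.
Qed.

Lemma cesaroB X Y M : ell1 X -> ell1 Y ->
  Defs.cesaro Q (X \- Y) M = Defs.cesaro Q X M \- Defs.cesaro Q Y M.
Proof. by move=> eX eY; rewrite cesaroD ?cesaroN//; exact: ell1N. Qed.

Lemma norm1_cesaro X M : ell1 X -> (norm1 (Defs.cesaro Q X M) <= norm1 X)%E.
Proof.
move=> eX; rewrite norm1Z.
(* At [M = 0] the factor is $0^{-1} = 0$, so the mean is the zero family. *)
case: M => [|M]; first by rewrite invr0 normr0 mul0e norm1_ge0.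
rewrite ger0_norm//; apply: (@le_trans _ _ (M.+1%:R^-1%:E * (\sum_(i < M.+1) norm1 X))%E).
  rewrite lee_pmul2l// ?lte_fin ?invr_gt0//.
  apply: le_trans (norm1_sum _ _) _; apply: lee_sum => i _.
  exact: norm1_iter_act.
rewrite -(fineK (ell1_fin_num eX)) sumEFin sumr_const card_ord -EFinM.
by rewrite -(mulr_natl (fine _)) mulrA mulVf ?mul1r.
Qed.

Lemma cesaro_coboundary M X : ell1 X ->
  Defs.cesaro Q (X \- act Q X) M =
  fun w => M%:R^-1 * (X \- iter M (act Q) X) w.
Proof.
move=> eX; apply/funext => w; rewrite /Defs.cesaro; congr (_ * _).
elim: M => [|M IH]; first by rewrite big_ord0 /= subrr.
rewrite big_ord_recr IH iter_actD ?iter_actN//=; [|exact: ell1_act|exact/ell1N/ell1_act].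
by rewrite -iterSr subrKA.
Qed.

Definition ergodic_null X := ell1 X /\
  forall e : R, 0 < e -> \forall M \near \oo, (norm1 (Defs.cesaro Q X M) <= e%:E)%E.

(** The telescoped sum has norm at most twice that of [X], whatever [M] is, and is divided by
    [M]. *)
Lemma ergodic_null_coboundary X : ell1 X -> ergodic_null (X \- act Q X).
Proof.
move=> eX; split=> [|e e0]; first by apply: ell1B => //; exact: ell1_act.
near=> M.
have M0 : (0 < M)%N by near: M; exact: nbhs_infty_gt.
rewrite cesaro_coboundary// norm1Z ger0_norm ?invr_ge0//.
have eXM := ell1_iter_act M eX.
apply: (@le_trans _ _ ((M%:R^-1)%:E * (2 * fine (norm1 X))%:E)%E).
  rewrite lee_pmul2l// ?lte_fin ?invr_gt0 ?ltr0n//.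
  apply: le_trans (norm1D _ _) _; rewrite norm1N mulr2n mulrDl mul1r EFinD.
  by rewrite fineK ?ell1_fin_num// leeD2l// norm1_iter_act.
rewrite -EFinM lee_fin ler_pdivrMl ?ltr0n// -ler_pdivrMr//.
by near: M; exact: nbhs_infty_ger.
Unshelve. all: by end_near. Qed.

Lemma ergodic_nullD X Y :
  ergodic_null X -> ergodic_null Y -> ergodic_null (X \+ Y).
Proof.
move=> [eX nX] [eY nY]; split => [|e e0]; first exact: ell1D.
have e20 : 0 < e / 2 by rewrite divr_gt0.
near=> M.
rewrite cesaroD//; apply: le_trans (norm1D _ _) _; rewrite (splitr e) EFinD leeD//.
- by near: M; exact: nX.
- by near: M; exact: nY.
Unshelve. all: by end_near. Qed.

(** Every Cesaro mean is a contraction for [norm1], so the approximation error stays below [e / 2]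
    uniformly in [M]. *)
Lemma ergodic_null_closed X : ell1 X ->
  (forall e : R, 0 < e -> exists Y, ergodic_null Y /\ (norm1 (X \- Y)%R <= e%:E)%E) ->
  ergodic_null X.
Proof.
move=> eX XY; split => // e e0.
have e20 : 0 < e / 2 by rewrite divr_gt0.
have [Y [[eY /(_ _ e20) nY] dXY]] := XY _ e20.
near=> M.
rewrite (_ : X = (X \- Y) \+ Y); last by apply/funext => w /=; rewrite subrK.
have eXY : ell1 (X \- Y) by exact: ell1B.
rewrite cesaroD//; apply: le_trans (norm1D _ _) _; rewrite (splitr e) EFinD leeD//.
- by apply: le_trans (norm1_cesaro _ eXY) _.
- by near: M; exact: nY.
Unshelve. all: by end_near. Qed.

End stochastic_operator.

(** * The operator killed at [w0] and the avoidance probabilities *)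

Section killed_operator.
Context {R : realType} {Omega : choiceType} (Q : Omega -> Omega -> R).
Hypothesis Q_stochastic : column_stochastic Q.
Variable w0 : Omega.
Implicit Types X Y : Omega -> R.

Let Q_ge0 i j : 0 <= Q i j.
Proof. by have [/(_ i j)/andP[]] := Q_stochastic. Qed.

Let Q_sum1 j : (\esum_(i in [set: Omega]) (Q i j)%:E = 1)%E.
Proof. by have [_] := Q_stochastic. Qed.

Definition off X : Omega -> R := fun w => if w == w0 then 0 else X w.

(* [avoid m j] is the probability that the chain started at [j] is not at [w0]
   at any of the times [1, ..., m]. *)
Fixpoint avoid (m : nat) (j : Omega) : R :=
  if m is m'.+1
  then fine (\esum_(i in [set: Omega]) (off (avoid m') i * Q i j)%:E)%E
  else 1.

(** The operator [A] of the opening overview. *)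
Definition killed X := off (act Q X).

Lemma off_ge0 X i : (forall j, 0 <= X j) -> 0 <= off X i.
Proof. by move=> X0; rewrite /off; case: ifP. Qed.

Let sum_off_bounds (v : Omega -> R) j : (forall i, 0 <= v i <= 1) ->
  (0 <= \esum_(i in [set: Omega]) (off v i * Q i j)%:E <= 1)%E.
Proof.
move=> v01; have v0 i : 0 <= v i by case/andP: (v01 i).
rewrite esum_ge0/=; last by move=> i _; rewrite lee_fin mulr_ge0// off_ge0.
rewrite -(Q_sum1 j); apply: le_esum => i _; rewrite lee_fin ler_piMl// /off.
by case: ifP => // _; case/andP: (v01 i).
Qed.

Let sum_off_fin_num (v : Omega -> R) j : (forall i, 0 <= v i <= 1) ->
  (\esum_(i in [set: Omega]) (off v i * Q i j)%:E)%E \is a fin_num.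
Proof.
move=> /(sum_off_bounds j) /andP[s0 s1].
by rewrite ge0_fin_numE//; apply: le_lt_trans s1 (ltry _).
Qed.

Lemma avoid_bounds m j : 0 <= avoid m j <= 1.
Proof.
elim: m j => [|m IH] j; first by rewrite ler01 lexx.
by rewrite -!lee_fin /= fineK ?sum_off_fin_num// sum_off_bounds.
Qed.

Lemma avoid_ge0 m j : 0 <= avoid m j.
Proof. by case/andP: (avoid_bounds m j). Qed.

Lemma avoidS m j : (avoid m.+1 j)%:E =
  (\esum_(i in [set: Omega]) (off (avoid m) i * Q i j)%:E)%E.
Proof. by rewrite fineK// sum_off_fin_num//; exact: avoid_bounds. Qed.

Lemma ell1_killed X : ell1 X -> ell1 (killed X).
Proof.
move=> /(ell1_act Q_stochastic); apply: le_ell1 => w.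
by rewrite /killed /off; case: ifP; rewrite ?normr0.
Qed.

Lemma ell1_iter_killed m X : ell1 X -> ell1 (iter m killed X).
Proof. by move=> eX; elim: m => //= m; exact: ell1_killed. Qed.

Lemma killed_ge0 X : ell1 X -> (forall w, 0 <= X w) -> forall w, 0 <= killed X w.
Proof. by move=> eX X0 w; apply: off_ge0 => i; exact: act_ge0. Qed.

Lemma iter_killed_ge0 m X : ell1 X -> (forall w, 0 <= X w) ->
  forall w, 0 <= iter m killed X w.
Proof.
by move=> eX X0; elim: m => //= m IH; apply: killed_ge0 => //; exact: ell1_iter_killed.
Qed.

(** [avoid] obeys the recursion adjoint to [killed], so [act_duality] transfers one step of the
    operator onto the weight. *)
Lemma norm1_iter_killed m X : ell1 X ->
  (norm1 (iter m killed X) <=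
   \esum_(j in [set: Omega]) (avoid m j * `|X j|)%:E)%E.
Proof.
elim: m X => [|m IH] X eX.
  by rewrite /=; apply: le_esum => j _; rewrite mul1r.
have eaX : ell1 (fun j => `|X j|) by rewrite /ell1/= norm1_normr.
rewrite iterSr; apply: le_trans (IH _ (ell1_killed eX)) _.
apply: (@le_trans _ _ (\esum_(i in [set: Omega])
    (off (avoid m) i * act Q (fun j => `|X j|) i)%:E)%E).
  apply: le_esum => i _; rewrite lee_fin /killed /off; case: ifP => _.
    by rewrite normr0 mulr0 mul0r.
  by rewrite ler_wpM2l ?avoid_ge0// act_normr.
rewrite act_duality//; last by move=> i; apply: off_ge0; exact: avoid_ge0.
by apply: le_esum => j _; rewrite -avoidS -EFinM mulrC.
Qed.

(** For the nonnegative sequences considered here, this is convergence to 0. *)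
Definition vanishing (u : nat -> R) :=
  forall e, 0 < e -> \forall m \near \oo, u m <= e.

(** One term of the recursion gives [Q i j * avoid m i <= avoid m.+1 j]; the condition [i != w0]
    ensures that [off] keeps this term. *)
Lemma avoid_vanishing_step i j : 0 < Q i j -> i != w0 ->
  vanishing (avoid^~ j) -> vanishing (avoid^~ i).
Proof.
move=> Qij iw0 vj e e0.
have /vj [N _ hN] : 0 < e * Q i j by rewrite mulr_gt0.
exists N => // m /= Nm; rewrite -(ler_pM2r Qij).
apply: le_trans (hN m.+1 (leqW Nm)); rewrite -lee_fin avoidS.
rewrite [X in (X%:E <= _)%E](_ : _ = off (avoid m) i * Q i j); last first.
  by rewrite /off (negPf iw0).
apply: (@esum_ge1 _ _ i (fun i => (off (avoid m) i * Q i j)%:E)) => k.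
by rewrite lee_fin mulr_ge0// off_ge0//; exact: avoid_ge0.
Qed.

(** If no [k] worked, all terms of the row sum would be nonpositive, so its positive part would
    vanish. This argument requires neither summability of the row nor the sign of [mpow]. *)
Lemma mpow_gt0S m i j : 0 < mpow Q m.+1 i j ->
  exists2 k, 0 < Q i k & 0 < mpow Q m k j.
Proof.
move=> /= s0; apply: contrapT => h; move: s0; apply/negP; rewrite -leNgt.
have q k : Q i k * mpow Q m k j <= 0.
  rewrite leNgt; apply/negP => q0; apply: h.
  have Qik : 0 < Q i k.
    rewrite lt_neqAle Q_ge0 andbT eq_sym.
    by apply: contraTneq q0 => ->; rewrite mul0r ltxx.
  by exists k => //; rewrite -(pmulr_rgt0 _ Qik).
rewrite /rsum [X in fine X](_ : _ = 0%E); last first.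
  by apply: esum1 => k _; rewrite max_r.
rewrite sub0r oppr_le0 fine_ge0// esum_ge0// => k _.
by rewrite lee_fin le_max lexx orbT.
Qed.

(** Induction on the length of a path from [w0] to [j]: the decay passes along its last transition,
    unless [j] is [w0] itself. *)
Lemma avoid_vanishing j : irreducible Q ->
  vanishing (avoid^~ w0) -> vanishing (avoid^~ j).
Proof.
move=> irr v0; have [m] := irr j w0; elim: m j => [|m IH] j.
  by rewrite /=; case: eqP => [->//|_]; rewrite ltxx.
move=> /mpow_gt0S[k Qjk /IH]; have [->//|jw0] := eqVneq j w0.
exact: avoid_vanishing_step.
Qed.

(** Dominated convergence: a finite [F] carries all but [e / 2] of the norm; on [F] the weights
    become uniformly small, and outside [F] they are at most 1. *)
Lemma weighted_norm1_vanishing X (v : nat -> Omega -> R) : ell1 X ->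
  (forall m j, 0 <= v m j <= 1) -> (forall j, vanishing (v^~ j)) ->
  forall e : R, 0 < e -> \forall m \near \oo,
    (\esum_(j in [set: Omega]) (v m j * `|X j|)%:E <= e%:E)%E.
Proof.
move=> eX v01 v0 e e0.
have e20 : 0 < e / 2 by rewrite divr_gt0.
have fX := ell1_fin_num eX.
have [_ [F [finF _] <-]] := ub_ereal_sup_adherent e20 fX.
rewrite -/(esum _ _) -/(norm1 X) -esum_fset//.
(* Chosen so that [d] times the norm is at most [e / 2]; the added 1 keeps the denominator positive
   when the norm is 0. *)
pose d := e / 2 / (fine (norm1 X) + 1).
have n0 : 0 <= fine (norm1 X) by rewrite fine_ge0// norm1_ge0.
have d0 : 0 < d by rewrite divr_gt0// ltr_wpDl.
(* Each [j] in [F] has its own threshold; finiteness of [F] makes it uniform. *)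
have nF : \forall m \near \oo, forall j, F j -> v m j <= d.
  apply: (filterS _ (@filter_bigI _ _ (fset_set F)
    (fun j => [set m | v m j <= d]) \oo _ (fun j _ => v0 j d d0))) => m hm j Fj.
  by apply: (hm j); rewrite /= in_fset_set// inE.
move=> hF; have {hF} hF : (norm1 X - (e / 2)%:E < \esum_(j in F) `|X j|%:E)%E by [].
near=> m.
have nFm : forall j, F j -> v m j <= d by near: m; exact: nF.
have vX0 j : 0 <= v m j * `|X j| by rewrite mulr_ge0//; case/andP: (v01 m j).
rewrite (esumID F); last by move=> j _; rewrite lee_fin.
rewrite !setTI (splitr e) EFinD leeD//.
  apply: (@le_trans _ _ (d%:E * norm1 X)%E).
    rewrite -norm1_normr -(gtr0_norm d0) -norm1Z esum_mkcond.
    apply: le_esum => j _; case: ifPn => [/set_mem Fj|_]; last by rewrite lee_fin.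
    by rewrite lee_fin normrM normr_id gtr0_norm// ler_wpM2r// nFm.
  rewrite -(fineK fX) -EFinM lee_fin /d mulrAC ler_pdivrMr ?ltr_wpDl//.
  by rewrite ler_pM2l// lerDl.
apply: (@le_trans _ _ (\esum_(j in ~` F) `|X j|%:E)%E).
  by apply: le_esum => j _; rewrite lee_fin ler_piMl//; case/andP: (v01 m j).
move: hF.
have fF : (\esum_(j in F) `|X j|%:E)%E \is a fin_num.
  rewrite ge0_fin_numE ?esum_ge0//; apply: le_lt_trans eX.
  by rewrite /norm1 (esumID F [set: Omega])// setTI leeDl// esum_ge0.
rewrite /norm1 (esumID F [set: Omega])// !setTI.
by rewrite lteBlDr// lteD2lE// => /ltW.
Unshelve. all: by end_near. Qed.

Let delta : Omega -> R := fun w => (w == w0)%:R.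

Let deltaN w : w != w0 -> delta w = 0.
Proof. by rewrite /delta => /negPf ->. Qed.

Let delta_ge0 w : 0 <= delta w.
Proof. by rewrite /delta ler0n. Qed.

Let norm1_delta : norm1 delta = 1%E.
Proof. by rewrite (norm1_support1 deltaN) /delta eqxx normr1. Qed.

Let ell1_delta : ell1 delta.
Proof. by rewrite /ell1/= norm1_delta ltry. Qed.

Let rsum_delta : rsum delta = 1.
Proof. by rewrite (rsum_support1 deltaN) /delta eqxx. Qed.

Let center X := X \- (fun w => rsum X * delta w).

Let norm1_center X : ell1 X -> (norm1 (center X) <= norm1 X + norm1 X)%E.
Proof.
move=> eX; apply: le_trans (norm1D _ _) _; rewrite norm1N leeD2l//.
by rewrite norm1Z norm1_delta mule1 normr_rsum.
Qed.

(** The mass [act Q X w0] erased by [killed] is also the drop in [rsum], since [Q] preserves sums;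
    the multiples of [delta] therefore cancel. *)
Let center_killed X : ell1 X ->
  center X \- center (killed X) = X \- act Q X.
Proof.
move=> eX; have eK := ell1_killed eX.
have actE : act Q X = killed X \+ (fun w => act Q X w0 * delta w).
  apply/funext => w; rewrite /killed /off /delta /=.
  by case: eqP => [->|_]; rewrite ?mulr1 ?add0r ?mulr0 ?addr0.
have rX : rsum X = rsum (killed X) + act Q X w0.
  rewrite -(rsum_act Q_stochastic eX) {1}actE rsumD//; last exact: ell1Z.
  by rewrite rsumZ// rsum_delta mulr1.
apply/funext => w; rewrite /center [in RHS]actE /= rX.
ring.
Qed.

(** By [center_killed], [center X] minus [center (iter N killed X)] is a finite sum of coboundaries.
    Here [center X] is [X], and the remainder is small for large [N]. *)
Lemma ergodic_null_rsum0 X : irreducible Q -> vanishing (avoid^~ w0) ->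
  ell1 X -> rsum X = 0 -> ergodic_null Q X.
Proof.
move=> irr v0 eX rX0.
have cX : center X = X.
  by apply/funext => w; rewrite /center /= rX0 mul0r subr0.
have nullN N : ergodic_null Q (center X \- center (iter N killed X)).
  elim: N => [|N IH].
    (* The zero family is the coboundary of zero. *)
    rewrite (_ : _ \- _ = (fun=> 0) \- act Q (fun=> 0)).
      by apply: ergodic_null_coboundary => //; rewrite /ell1/= norm1_0 ltry.
    apply/funext => w /=; rewrite subrr sub0r /act.
    rewrite (@rsum_support1 _ _ w) ?mulr0 ?oppr0// => j _.
    by rewrite mulr0.
  have eN := ell1_iter_killed N eX.
  have := ergodic_nullD Q_stochastic IH (ergodic_null_coboundary Q_stochastic eN).
  congr ergodic_null; rewrite -center_killed//; apply/funext => w /=.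
  by rewrite addrA subrK.
apply: ergodic_null_closed => // e e0.
have e20 : 0 < e / 2 by rewrite divr_gt0.
(* The bound [e / 2] is requested because [center] may double the norm. *)
have [N _ hN] := weighted_norm1_vanishing eX avoid_bounds
  (fun j => avoid_vanishing j irr v0) e20.
exists (center X \- center (iter N killed X)); split => //.
rewrite (_ : X \- _ = center (iter N killed X)); last first.
  by apply/funext => w /=; rewrite cX opprB addrC subrK.
have eN := ell1_iter_killed N eX.
have n2 : (norm1 (iter N killed X) <= (e / 2)%:E)%E.
  by apply: le_trans (norm1_iter_killed _ eX) _; exact: (hN N (leqnn N)).
by apply: le_trans (norm1_center eN) _; rewrite (splitr e) EFinD leeD.
Qed.


Lemma vanishing_series (u : nat -> R) C : (forall m, 0 <= u m) ->
  (forall N, \sum_(m < N) u m <= C) -> vanishing u.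
Proof.
move=> u0 uC e e0.
have : cvgn (series u).
  apply: nondecreasing_is_cvgn.
    by apply/nondecreasing_seqP => n; rewrite seriesSr lerDl.
  by exists C => _ [n _ <-]; rewrite /series /= big_mkord.
move=> /cvg_series_cvg_0 /cvgr0Pnorm_le /(_ e e0); apply: filterS => m.
by rewrite ger0_norm.
Qed.

(** * An invariant vector of finite mass *)

Section invariant_vector.
Variable C : R.
Hypothesis avoid_series : forall N, \sum_(m < N) avoid m w0 <= C.

(* The expected number of visits before the first return to [w0]. *)
Let mu i : R := fine (\esum_(m in [set: nat]) (iter m killed delta i)%:E)%E.

Let f0 m i : 0 <= iter m killed delta i.
Proof. exact: iter_killed_ge0. Qed.

(** As [delta] is supported at [w0], the bound of [norm1_iter_killed] reduces to [avoid m w0].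
    Together with Tonelli, this bounds the mass of [mu] by [C]. *)
Let sum_norm1 :
  (\esum_(m in [set: nat]) norm1 (iter m killed delta) <= C%:E)%E.
Proof.
rewrite -nneseries_esumT; last by move=> m; exact: norm1_ge0.
apply: lime_le; first by apply: is_cvg_nneseries => m _ _; exact: norm1_ge0.
apply: nearW => N; rewrite big_mkord.
apply: (@le_trans _ _ (\sum_(m < N) avoid m w0)%:E); last by rewrite lee_fin.
rewrite -sumEFin; apply: lee_sum => m _.
apply: le_trans (norm1_iter_killed _ ell1_delta) _.
rewrite (@esum_support1 _ _ w0).
- by rewrite /delta eqxx normr1 mulr1.
- by rewrite lee_fin mulr_ge0// avoid_ge0.
- by move=> i /deltaN ->; rewrite normr0 mulr0.
Qed.

Let sum_le : (\esum_(i in [set: Omega]) \esum_(m in [set: nat])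
  (iter m killed delta i)%:E <= C%:E)%E.
Proof.
rewrite esum_interchange; last by move=> i m; rewrite lee_fin.
by under eq_esum do rewrite -ge0_norm1//.
Qed.

(** The total mass bound makes each entry finite, so [fine] in [mu] loses nothing. *)
Let muE i : (mu i)%:E = (\esum_(m in [set: nat]) (iter m killed delta i)%:E)%E.
Proof.
rewrite fineK// ge0_fin_numE; last by apply: esum_ge0 => m _; rewrite lee_fin.
apply: le_lt_trans (ltry C); apply: le_trans sum_le.
apply: (@esum_ge1 _ _ i (fun i => \esum_(m in [set: nat]) (iter m killed delta i)%:E)%E).
by move=> j; apply: esum_ge0 => m _; rewrite lee_fin.
Qed.

Let mu0 i : 0 <= mu i.
Proof. by rewrite -lee_fin muE; apply: esum_ge0 => m _; rewrite lee_fin. Qed.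

Let ell1_mu : ell1 mu.
Proof.
rewrite /ell1/= ge0_norm1//; apply: le_lt_trans (ltry C).
by under eq_esum do rewrite muE.
Qed.

(** The term [m = 0] alone contributes mass 1 at [w0]. *)
Let rsum_mu : 0 < rsum mu.
Proof.
rewrite -lte_fin rsum_norm1//.
apply: (@lt_le_trans _ _ `|mu w0|%:E); last exact: norm1_ge1.
rewrite ger0_norm// muE; apply: (@lt_le_trans _ _ (delta w0)%:E).
  by rewrite /delta eqxx lte_fin.
apply: (@esum_ge1 _ _ 0%N (fun m => (iter m killed delta w0)%:E)) => m.
by rewrite lee_fin.
Qed.

(** Away from [w0], [killed] agrees with [act Q] and [delta] vanishes, so applying [Q] merely shifts
    the series. *)
Let act_mu : act Q mu = mu.
Proof.
have eQmu := ell1_act Q_stochastic ell1_mu.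
have off0 i : i != w0 -> act Q mu i = mu i.
  move=> iw0; apply: EFin_inj; rewrite ge0_actE// muE esum_nat_recl; last first.
    by move=> m; rewrite lee_fin.
  rewrite /= deltaN// add0e.
  transitivity (\esum_(j in [set: Omega]) \esum_(m in [set: nat])
      (Q i j * iter m killed delta j)%:E)%E.
    apply: eq_esum => j _; rewrite EFinM muE -esumZl// => m.
    by rewrite lee_fin.
  rewrite esum_interchange; last by move=> j m; rewrite lee_fin mulr_ge0.
  apply: eq_esum => m _; rewrite /killed /off (negPf iw0) ge0_actE//.
  exact: ell1_iter_killed.
apply/funext => i; have [->|/off0//] := eqVneq i w0.
(* The difference is supported at [w0], so its value there is its sum, which is 0 because [Q]
   preserves sums. *)
apply/eqP; rewrite -subr_eq0; apply/eqP.
rewrite -[LHS](@rsum_support1 _ _ w0 (act Q mu \- mu)).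
  by rewrite rsumB// rsum_act// subrr.
by move=> j /off0 /= ->; rewrite subrr.
Qed.

(** The limit [Y] is the multiple of [mu] with the same sum as [X]: then [X \- Y] has sum 0 and [Y]
    is invariant. *)
Lemma ell1_me_avoid X : irreducible Q -> ell1 X -> ell1_me Q X.
Proof.
move=> irr eX; split => //; set a := rsum X / rsum mu.
pose Y w := a * mu w; have eY : ell1 Y by exact: ell1Z.
have actY : act Q Y = Y.
  apply/funext => i; transitivity (a * act Q mu i); last by rewrite act_mu.
  rewrite /act /Y -rsumZ; last exact: ell1_row.
  by congr rsum; apply/funext => j; rewrite mulrCA.
exists Y => //.
have [_ nZ] : ergodic_null Q (X \- Y).
  apply: ergodic_null_rsum0 => //.
  - by apply: (@vanishing_series _ C) => // m; exact: avoid_ge0.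
  - exact: ell1B.
  - by rewrite rsumB// rsumZ// /a divfK ?subrr// gt_eqF.
have {}nZ e : 0 < e ->
    \forall M \near \oo, (norm1 (Defs.cesaro Q X M \- Y)%R <= e%:E)%E.
  move=> e0; near=> M.
  (* The mean of the invariant [Y] equals [Y] only for positive [M]. *)
  have M0 : (0 < M)%N by near: M; exact: nbhs_infty_gt.
  rewrite (_ : _ \- _ = Defs.cesaro Q (X \- Y) M); first by near: M; exact: nZ.
  rewrite cesaroB//; congr (_ \- _); apply/funext => w.
  rewrite /Defs.cesaro (eq_bigr (fun=> Y w)).
    by rewrite sumr_const card_ord -(mulr_natl (Y w)) mulKf// pnatr_eq0 -lt0n.
  move=> i _; congr (_ w); elim: (nat_of_ord i) => //= n ->.
  exact: actY.
(* The bound with [e = 1] makes the norms eventually finite, which reduces the limit in [\bar R] to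
   a real one. *)
rewrite /cvg1; apply/fine_cvgP; split.
  have := nZ 1 ltr01; apply: filterS => M h.
  by rewrite ge0_fin_numE ?norm1_ge0//; apply: le_lt_trans h (ltry _).
apply/cvgr0Pnorm_le => e e0; have := nZ e e0; apply: filterS => M h /=.
have h0 := norm1_ge0 (Defs.cesaro Q X M \- Y).
rewrite ger0_norm ?fine_ge0// -lee_fin fineK//.
by rewrite ge0_fin_numE//; apply: le_lt_trans h (ltry _).
Unshelve. all: by end_near. Qed.

End invariant_vector.
End killed_operator.

(* Unlike [ge0_le_integral], no measurability is required. *)
Lemma ge0_le_integralT d (T : measurableType d) (R : realType)
    (mu : {measure set T -> \bar R}) (f g : T -> \bar R) :
  (forall t, 0 <= f t)%E -> (forall t, f t <= g t)%E ->
  (\int[mu]_t f t <= \int[mu]_t g t)%E.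
Proof.
move=> f0 fg; have g0 t : (0 <= g t)%E by apply: le_trans (f0 t) (fg t).
rewrite !ge0_integralTE//; apply: ge_ereal_sup => _ [h hf <-].
by apply: ereal_sup_ubound; exists h => // t; apply: le_trans (hf t) (fg t).
Qed.

(** * Avoidance probabilities of a realized chain and its return time *)

Section return_time_tail.
Context {R : realType} {Omega : choiceType} (Q : Omega -> Omega -> R).
Hypothesis Omega_countably_infinite : countably_infinite Omega.
Hypothesis Q_stochastic : column_stochastic Q.
Context d (T : measurableType d) (P : probability T R) (X : nat -> T -> Omega).
Hypothesis X_chain : markov_chain Q P X.
Variable w0 : Omega.

Let mX n (A : set Omega) : measurable (X n @^-1` A).
Proof. by have [mX _] := X_chain; exact: mX. Qed.

Lemma measure_state_partition n (B : set T) : measurable B ->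
  P B = (\esum_(i in [set: Omega]) P (B `&` X n @^-1` [set i]))%E.
Proof.
(* Measures are additive over sequences, so the states are numbered by a bijection [f] onto
   [nat]. *)
move=> mB; have [cO /(eq_card_nat cO) /card_set_bijP[f [_ f_inj f_surj]]] :=
  Omega_countably_infinite.
have injf i j : f i = f j -> i = j by apply: f_inj; rewrite inE.
pose F k := B `&` X n @^-1` [set i | f i = k].
have BE : B = \bigcup_k F k.
  by apply/seteqP; split => [t Bt|t [k _ []]//]; exists (f (X n t)).
rewrite [in LHS]BE measure_bigcup//; last 2 first.
- by move=> k _; apply: measurableI => //; exact: mX.
- by move=> k l _ _ [t [[_ /= <-] [_ /= <-]]].
rewrite nneseries_esum; last by move=> k _; exact: measure_ge0.
rewrite (reindex_esum [set: Omega] _ f); last first.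
  split => //; first by move=> i _ /=; rewrite inE.
  by move=> k _; apply: f_surj.
apply: eq_esum => i _; congr (P (_ `&` _)); apply/seteqP; split => t /=.
  exact: injf.
by move=> ->.
Qed.

Lemma measurable_history s n : measurable (history X s n).
Proof.
rewrite (_ : history X s n =
    \bigcap_(k in [set k | (k <= n)%N]) X k @^-1` [set s k]).
  by apply: bigcap_measurableType => k _; exact: mX.
by apply/seteqP; split => [t h k /= kn|t h k kn]; exact: h.
Qed.

Lemma prob_historyS s n : P (history X s n.+1) =
  ((Q (s n.+1) (s n))%:E * P (history X s n))%E.
Proof.
have -> : history X s n.+1 = X n.+1 @^-1` [set s n.+1] `&` history X s n.
  apply/seteqP; split => [t h|t [h1 h] k].
    by split; [exact: h|move=> k kn; apply: h; exact: leqW].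
  by rewrite leq_eqVlt => /predU1P[->//|]; rewrite ltnS; exact: h.
have mH := measurable_history s n.
have mI : measurable (X n.+1 @^-1` [set s n.+1] `&` history X s n).
  by apply: measurableI => //; exact: mX.
(* The Markov property says nothing about a null history; there both sides are 0. *)
have [H0|H0] := eqVneq (P (history X s n)) 0%E.
  rewrite H0 mule0; apply/eqP; rewrite eq_le measure_ge0 andbT -H0.
  by rewrite le_measure ?inE.
have [_ /(_ n s H0)] := X_chain; rewrite /cond_prob => <-.
rewrite -[X in (_ * X)%E]fineK ?fin_num_measure// -EFinM divfK ?fineK ?fin_num_measure//.
by rewrite fine_eq0 ?fin_num_measure.
Qed.

(** Time [n] is excluded, as in [avoid], so the chain may sit at [w0] then. *)
Let avoids n m : set T := [set t | forall l, (n < l <= n + m)%N -> X l t <> w0].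

Lemma measurable_avoids n m : measurable (avoids n m).
Proof.
rewrite (_ : avoids n m =
    \bigcap_(l in [set l | (n < l <= n + m)%N]) X l @^-1` [set~ w0]).
  by apply: bigcap_measurableType => k _; exact: mX.
by apply/seteqP; split => [t h k /= kn|t h k kn]; exact: h.
Qed.

(** Splitting by the state at time [n.+1] turns each piece into a longer history with one step fewer
    to avoid; hence the induction varies [n] and [s]. *)
Lemma prob_history_avoids m n s : P (history X s n `&` avoids n m) =
  (P (history X s n) * (avoid Q w0 m (s n))%:E)%E.
Proof.
elim: m n s => [|m IH] n s.
  rewrite mule1 (_ : avoids _ _ = setT) ?setIT//.
  apply/seteqP; split => // t _ l.
  by rewrite addn0 => /andP[/leq_trans h /h]; rewrite ltnn.
have mHA : measurable (history X s n `&` avoids n m.+1).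
  by apply: measurableI; [exact: measurable_history|exact: measurable_avoids].
rewrite (measure_state_partition n.+1 mHA) avoidS//.
rewrite -[X in (X * _)%E]fineK ?fin_num_measure//; last exact: measurable_history.
rewrite -esumZl; last 2 first.
- exact: fine_ge0.
- move=> i; rewrite lee_fin mulr_ge0//; last first.
    by have [/(_ i (s n))/andP[]] := Q_stochastic.
  by apply: off_ge0 => j; exact: avoid_ge0.
(* The piece with [i = w0] is empty, matching the entry erased by [off]. *)
apply: eq_esum => i _; rewrite /off; case: eqVneq => [->|iw0].
  rewrite mul0r mule0 (_ : _ `&` _ = set0) ?measure0//.
  apply/seteqP; split => // t [[_ h] /= Xt].
  by apply: (h n.+1) => //; rewrite addnS !ltnS leqnn leq_addr.
(* The history extended by [i] at time [n.+1]; its later values are immaterial. *)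
pose s' k := if (k <= n)%N then s k else i.
have s'n : s' n = s n by rewrite /s' leqnn.
have s'n1 : s' n.+1 = i by rewrite /s' ltnn.
have HE : history X s' n = history X s n.
  by apply/seteqP; split => t h k kn; rewrite h /s' ?kn.
rewrite (_ : _ `&` _ = history X s' n.+1 `&` avoids n.+1 m).
  rewrite IH prob_historyS s'n s'n1 HE fineK ?fin_num_measure//; last first.
    exact: measurable_history.
  by rewrite (muleC (Q _ _)%:E) -muleA -EFinM (mulrC (Q _ _)).
apply/seteqP; split => [t [[h a] /= Xi]|t [h a]].
  split => [k|l /andP[nl lm]].
    rewrite leq_eqVlt => /predU1P[->|]; first by rewrite s'n1.
    by rewrite ltnS => kn; rewrite /s' kn; exact: h.
  by apply: a; rewrite ltnW//= -addSnnS.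
have Xi : X n.+1 t = i by rewrite h.
split => //; split => [k kn|l /andP[nl lm]].
  by rewrite h 1?leqW// /s' kn.
have [ln|ln] := leqP l n.+1; last by apply: a; rewrite ln/= addSnnS.
rewrite (_ : l = n.+1); last by apply/eqP; rewrite eqn_leq ln.
by rewrite Xi; exact/eqP.
Qed.

(** A truncated tail formula: [avoids 0 m] is the event that the return time exceeds [m], and at
    most $T_R$ indices [m] satisfy $m < T_R$. *)
Lemma sum_avoid_le_return_time N : {ae P, forall t, X 0%N t = w0} ->
  ((\sum_(m < N) avoid Q w0 m w0)%:E <= \int[P]_t return_time X w0 t)%E.
Proof.
move=> X0.
have H1 : P (history X (fun=> w0) 0) = 1%E.
  have mH := measurable_history (fun=> w0) 0.
  have : P (~` history X (fun=> w0) 0) = 0%E.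
    apply/negligibleP; first exact: measurableC.
    apply: negligibleS X0 => t h /= Xt; apply: h => k.
    by rewrite leqn0 => /eqP ->.
  rewrite probability_setC// => /eqP.
  rewrite -(fineK (fin_num_measure P _ mH)) -EFinB eqe subr_eq0 => /eqP <- //.
have pA m : ((avoid Q w0 m w0)%:E <= P (avoids 0 m))%E.
  have := prob_history_avoids m 0 (fun=> w0); rewrite H1 mul1e => <-.
  have mA := measurable_avoids 0 m.
  apply: le_measure; rewrite ?inE//.
  by apply: measurableI => //; exact: measurable_history.
apply: (@le_trans _ _ (\int[P]_t (\sum_(m < N) (\1_(avoids 0 m) t)%:E))%E).
  rewrite ge0_integral_sum//; last first.
    move=> m; apply/measurable_EFinP; apply: measurable_indic.
    exact: measurable_avoids.
  rewrite -sumEFin; apply: lee_sum => m _.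
  by rewrite integral_indic ?setIT//; exact: measurable_avoids.
apply: ge0_le_integralT => t.
  by apply: sume_ge0 => m _; rewrite lee_fin.
(* A lower bound on the infimum is tested against each return [k]; paths that never return are
   covered too. *)
apply: le_ereal_inf_tmp => _ [k [k1 Xk] <-].
rewrite sumEFin lee_fin.
apply: (@le_trans _ _ (\sum_(m < N) (m < k)%N%:R)).
  apply: ler_sum => m _; rewrite indicE; case: (ltnP m k) => [_|km].
    by rewrite lern1 leq_b1.
  by rewrite memNset// => /(_ k); rewrite k1 add0n km => /(_ isT).
rewrite -natr_sum ler_nat (_ : (\sum_(m < N) (m < k))%N = minn N k) ?geq_minr//.
elim: N => [|N IH]; first by rewrite big_ord0 min0n.
by rewrite big_ord_recr/= IH; case: ltnP => ?; lia.
Qed.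
End return_time_tail.

Theorem theorem14 (R : realType) (Omega : choiceType) (Q : Omega -> Omega -> R)
  (Omega_countably_infinite : countably_infinite Omega)
  (Q_stochastic : column_stochastic Q)
  (Q_irreducible : irreducible Q)
  (Q_positive_recurrent : positive_recurrent Q) :
  ell1_me Q = ell1.
Proof.
apply/seteqP; split => [X []//|X eX].
have [w0 _] : [set: Omega] !=set0.
  by have [_ /infinite_setN0] := Omega_countably_infinite.
have [d [T [P [Y [Y_chain Y0 _ ET]]]]] := Q_positive_recurrent w0.
(* The constant [C] is the expected return time, finite by positive recurrence. *)
apply: (@ell1_me_avoid _ _ _ Q_stochastic w0 (fine (\int[P]_t return_time Y w0 t)))
  => // N.
have ge0 : (0 <= \int[P]_t return_time Y w0 t)%E.
  apply: integral_ge0 => t _; apply: le_ereal_inf_tmp => _ [k _ <-].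
  by rewrite lee_fin.
rewrite -lee_fin fineK ?ge0_fin_numE//.
exact: (sum_avoid_le_return_time Omega_countably_infinite Q_stochastic Y_chain).
Qed.
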